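(* Let $\mathcal{X}\subseteq\mathbb{R}^n$ be a nonempty compact set, let $\phi:\mathbb{R}^n\to\mathbb{R}$ and $R:\mathbb{R}^n\to\mathbb{R}$, and let $\beta(\cdot)$, $\alpha(\cdot)$, $\bar a$ be defined as in the context. Let $a\le\bar a$, let $\tilde{x}$ be a feasible solution of the problem defining $\beta(a)$ (that is, $\tilde{x}\in\mathcal{X}$ and $R(\tilde{x})\ge a$), and let $\delta\ge 0$. If $\alpha(\phi(\tilde{x})-\delta)<a$, then $$\phi(\tilde{x})-\delta\le\beta(a)\le\phi(\tilde{x}).$$
   Context: For $a,b\in\mathbb{R}$ define $$\beta(a)=\min\{\phi(x): R(x)\ge a,\ x\in\mathcal{X}\},\qquad \alpha(b)=\max\{R(x): \phi(x)\le b,\ x\in\mathcal{X}\},$$ with the convention $\beta(a)=+\infty$ (resp. $\alpha(b)=-\infty$) if the corresponding problem is infeasible. Define also $\bar a=\max\{R(x): x\in\mathcal{X}\}$. All these minima and maxima are understood to be attained whenever the corresponding problem is feasible. *)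

(* Defs.v *)
From HB Require Import structures.
From mathcomp Require Import all_boot all_order all_algebra.
From mathcomp Require Import all_classical all_reals all_analysis.

Set Implicit Arguments.
Unset Strict Implicit.
Unset Printing Implicit Defensive.

Import Order.TTheory GRing.Theory Num.Theory.
Import numFieldNormedType.Exports.

Local Open Scope classical_set_scope.
Local Open Scope ring_scope.

Definition minimums (K : realType) (A : set K) : set K := A `&` lbound A.
Definition maximums (K : realType) (A : set K) : set K := A `&` ubound A.

(* The minimum is a genuine minimum, not an infimum: the default +oo covers the
   infeasible problem, but it is also returned for a nonempty A without a least
   element, so attainment has to be assumed where these values are used.
   Symmetrically for the maximum and -oo. *)
Definition min_value (K : realType) (A : set K) : \bar K :=
  xget +oo%E [set m%:E | m in minimums A].
Definition max_value (K : realType) (A : set K) : \bar K :=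
  xget -oo%E [set m%:E | m in maximums A].

Definition attains_min (K : realType) (A : set K) : Prop :=
  A !=set0 -> minimums A !=set0.
Definition attains_max (K : realType) (A : set K) : Prop :=
  A !=set0 -> maximums A !=set0.

Section Problems.
Context (K : realType) (n : nat) (X : set 'rV[K]_n) (phi R : 'rV[K]_n -> K).

Definition beta_values (a : K) : set K := [set phi x | x in [set x | a <= R x /\ X x]].
Definition alpha_values (b : K) : set K := [set R x | x in [set x | phi x <= b /\ X x]].

Definition beta (a : K) : \bar K := min_value (beta_values a).
Definition alpha (b : K) : \bar K := max_value (alpha_values b).
Definition abar : \bar K := max_value [set R x | x in X].

Definition optima_attained : Prop :=
  [/\ forall a, attains_min (beta_values a),
      forall b, attains_max (alpha_values b)
    & attains_max [set R x | x in X]].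
End Problems.

(* Main.v *)
Require Import Defs.
From HB Require Import structures.
From mathcomp Require Import all_boot all_order all_algebra.
From mathcomp Require Import all_classical all_reals all_analysis.

Set Implicit Arguments.
Unset Strict Implicit.
Unset Printing Implicit Defensive.

Import Order.TTheory GRing.Theory Num.Theory.
Import numFieldNormedType.Exports.

Local Open Scope classical_set_scope.
Local Open Scope ring_scope.

(** The upper bound holds because [xt] itself competes in the minimization. For the lower bound, a
    minimizer [x] costing less than [phi xt - delta] would fit the budget of the maximization and,
    as [a <= R x], push its value up to at least [a]. Both halves need real optima instead of the
    default infinities, which [min_value_attained] and [max_value_attained] supply. *)

Lemma min_value_attained (K : realType) (A : set K) :
  attains_min A -> A !=set0 -> exists2 m, minimums A m & min_value A = m%:E.
Proof.
move=> minA /minA[m Am].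
have [m' Am' <-] : [set m%:E | m in minimums A] (min_value A).
  (* One minimum suffices for [xget] to return a member of the set and not its default [+oo]. *)
  by apply: xgetPex; exists m%:E, m.
by exists m'.
Qed.

Lemma max_value_attained (K : realType) (A : set K) :
  attains_max A -> A !=set0 -> exists2 m, maximums A m & max_value A = m%:E.
Proof.
move=> maxA /maxA[m Am].
have [m' Am' <-] : [set m%:E | m in maximums A] (max_value A).
  by apply: xgetPex; exists m%:E, m.
by exists m'.
Qed.

Theorem proposition1 (K : realType) (n : nat) (X : set 'rV[K]_n)
    (phi R : 'rV[K]_n -> K) (X_neq0 : X !=set0) (X_compact : compact X)
    (attained : optima_attained X phi R)
    (a : K) (a_le : (a%:E <= abar X R)%E)
    (xt : 'rV[K]_n) (xt_X : X xt) (xt_feas : a <= R xt)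
    (delta : K) (delta_ge0 : 0 <= delta)
    (alpha_lt : (alpha X phi R (phi xt - delta)%R < a%:E)%E) :
  ((phi xt - delta)%:E <= beta X phi R a)%E /\
  (beta X phi R a <= (phi xt)%:E)%E.
Proof.
have [minP maxP _] := attained.
have beta_neq0 : beta_values X phi R a !=set0 by exists (phi xt), xt.
have [m [[x [aRx Xx] phix] m_lb] betaE] := min_value_attained (minP a) beta_neq0.
rewrite /beta betaE !lee_fin; split; last by apply: m_lb; exists xt.
(* Otherwise the minimizer [x] would be feasible for [alpha (phi xt - delta)],
   whose value would then be at least [R x >= a]. *)
rewrite leNgt; apply/negP => m_lt.
have Rx_val : alpha_values X phi R (phi xt - delta) (R x).
  by exists x => //; split=> //; rewrite phix ltW.
(* Feasibility of [x] rules out the default [-oo], with which [alpha_lt] would give no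
   contradiction. *)
have [M [_ M_ub] alphaE] := max_value_attained (maxP _) (ex_intro _ _ Rx_val).
move: alpha_lt; rewrite /alpha alphaE lte_fin ltNge.
by rewrite (le_trans aRx (M_ub _ Rx_val)).
Qed.
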